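(* Let $N>1$. For $i=1,\dots,N$ let $U_i$ be a reflexive real Banach space, $U=U_1\times\dots\times U_N$, and let $\mathcal S_i:U\to C([0,T];Y)$ be the strategy-to-state map of the linear evolution equation described in the context. Let $U_i^{\rm ad}\subset U_i$ be nonempty, bounded, closed and convex, $U^{\rm ad}=\prod_iU_i^{\rm ad}$, let $O_i\subset U_i$ be open and convex with $U_i^{\rm ad}\subset O_i$, and $O=\prod_iO_i$. Let $\mathcal J_i:O\to\mathbb R$ be weakly lower semicontinuous and such that $\mathcal J_i(\cdot,u_{-i}):O_i\to\mathbb R$ is convex and continuous for each $u_{-i}\in O_{-i}$. Assume there are Banach spaces $X,W$ with $X$ compactly embedded in $W$ such that for each $i$, $\mathcal S_i$ takes values in $X$ and $\mathcal S_i:U\to X$ is Lipschitz, and let $\mathcal K_i\subset W$ be nonempty, closed and convex. Assume there is $u\in U^{\rm ad}$ with $\mathcal S_i(u)\in\mathcal K_i$ for all $i$. (a) Let $u^*$ be a generalized Nash equilibrium and assume that $u^*$ is a continuity point with respect to player $i$ for each $i$. Then there exist $\Phi=(y_1^*,\dots,y_N^* )\in X^N$, $\lambda=(\lambda_1,\dots,\lambda_N)\in U^*=\prod_i U_i^*$ and $\mu=(\mu_1,\dots,\mu_N)\in [W^*]^N$ such that for each $i=1,\dots,N$: $$\begin{cases} y_i^*=\mathcal S_i(u^* ),\\ \lambda_i\in\mathcal N_{U_i^{\rm ad}}(u_i^* ),\\ \mu_i\in\mathcal N_{\mathcal K_i}(\mathcal S_i(u^* )),\\ 0\in\partial_i\mathcal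 J_i(u^* )+\lambda_i+[\mathcal S_i^{0,i}]^*\mu_i\quad\text{in }U_i^*.\end{cases}$$ (b) Conversely, if $u^*\in U$ and $(\Phi,\lambda,\mu)\in X^N\times U^*\times[W^*]^N$ satisfy this system for each $i$, then $u^*$ is a generalized Nash equilibrium.
   Context: Notation: for $u\in U$, $u_{-i}$ is the collection of components $u_j$, $j\neq i$; $O_{-i}=\prod_{j\neq i}O_j$; $u=(u_i,u_{-i})$ without changing the order of coordinates. State equation. Let $T>0$ and let $Y$ be a real Banach space. $\mathcal A:\mathcal D(\mathcal A)\subset Y\to Y$ is a closed, densely defined linear operator generating a $C_0$-semigroup $\{S(t)\}_{t\ge0}$ on $Y$. For each $i$, $\mathcal B_i:U\to L^2(0,T;Y)$ is linear and weak-to-strong continuous (maps weakly convergent sequences to norm convergent ones); $\mathcal P_i(t)\in\mathcal L(Y)$ for each $t\in[0,T]$ and $\mathcal P_i(\cdot)y\in C([0,T];Y)$ for each $y\in Y$; $f\in L^1(0,T;Y)$ and $y_0\in Y$. For $u\in U$, $\mathcal S_i(u)=y\in C([0,T];Y)$ is the unique (mild) solution of $$y(t)=S(t)y_0+\int_0^tS(t-\tau)\big[\mathcal P_i(\tau)y(\tau)+(\mathcal B_iu)(\tau)+f(\tau)\big]\,d\tau,\quad t\in[0,T].$$ $X$ is a Banach space of functions on $[0,T]$ with pointwise linear operations. $\mathcal S_i^0$ denotes the solution map for $y_0=0$ and $f=0$; it is the linear part of the affine map $\mathcal S_i$, so $\mathcal S_i(u)=\mathcal S_i(0)+\mathcal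 S_i^0(u)$, and it is bounded from $U$ to $X$, hence to $W$. $\mathcal S_i^{0,i}:U_i\to W$ is $\mathcal S_i^0\circ e_i$, where $e_i(u_i)\in U$ has $i$-th component $u_i$ and all other components $0$; $[\mathcal S_i^{0,i}]^*:W^*\to U_i^*$ is its adjoint. Generalized Nash equilibrium: $u^*\in U^{\rm ad}$ such that for each $i$, $\mathcal S_i(u^* )\in\mathcal K_i$ and $\mathcal J_i(u^* )\le\mathcal J_i(v_i,u^*_{-i})$ for all $v_i\in U_i^{\rm ad}$ with $\mathcal S_i(v_i,u_{-i}^* )\in\mathcal K_i$. Continuity point with respect to player $i$: a point $u\in U$ for which there is $\varepsilon>0$ such that $B_\varepsilon(0)\subset\mathcal S_i(u)-\mathcal K_i$, where $B_\varepsilon(0)$ is the ball in $W$ of radius $\varepsilon$ centered at $0$. For a convex set $C$ in a Banach space $Z$ and $z\in C$, $\mathcal N_C(z)=\{\zeta\in Z^*:\ \zeta(v-z)\le0\ \ \forall v\in C\}$; the normal cone is only defined at points of $C$, so $\zeta\in\mathcal N_C(z)$ includes the assertion $z\in C$. $\partial_i\mathcal J_i(u^* )\subset U_i^*$ is the convex subdifferential of $\mathcal J_i(\cdot,u_{-i}^* ):O_i\to\mathbb R$ at $u_i^*$. *)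

(* Defs.v *)
From HB Require Import structures.
From mathcomp Require Import all_boot all_order all_algebra.
From mathcomp Require Import all_classical all_reals all_analysis.
From mathcomp Require Import ring.

Set Implicit Arguments.
Unset Strict Implicit.
Unset Printing Implicit Defensive.

Import Order.TTheory GRing.Theory Num.Theory.
Import numFieldNormedType.Exports.

Local Open Scope classical_set_scope.
Local Open Scope ring_scope.

(* Index-wise product of normed spaces; the maximum norm is one of the
   equivalent norms that induce the product topology. *)
Definition prod_space (R : realType) (I : finType) (U : I -> normedModType R) :
  Type := forall i, U i.

Section prod_space.
Variables (R : realType) (I : finType) (U : I -> normedModType R).
Implicit Types u v w : prod_space U.

HB.instance Definition _ := gen_eqMixin (prod_space U).
HB.instance Definition _ := gen_choiceMixin (prod_space U).

Let add u v : prod_space U := fun i => u i + v i.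
Let opp u : prod_space U := fun i => - u i.
Let zero : prod_space U := fun=> 0.
Let scale (a : R) u : prod_space U := fun i => a *: u i.

Let addA : associative add.
Proof. by move=> u v w; apply: functional_extensionality_dep => i; exact: addrA. Qed.
Let addC : commutative add.
Proof. by move=> u v; apply: functional_extensionality_dep => i; exact: addrC. Qed.
Let add0 : left_id zero add.
Proof. by move=> u; apply: functional_extensionality_dep => i; exact: add0r. Qed.
Let addN : left_inverse zero opp add.
Proof. by move=> u; apply: functional_extensionality_dep => i; exact: addNr. Qed.

HB.instance Definition _ := GRing.isZmodule.Build (prod_space U) addA addC add0 addN.

Let scaleA a b u : scale a (scale b u) = scale (a * b) u.
Proof. by apply: functional_extensionality_dep => i; exact: scalerA. Qed.
Let scale1 : left_id 1 scale.
Proof. by move=> u; apply: functional_extensionality_dep => i; exact: scale1r. Qed.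
Let scaleDr : right_distributive scale +%R.
Proof. by move=> a u v; apply: functional_extensionality_dep => i; exact: scalerDr. Qed.
Let scaleDl u : {morph scale^~ u : a b / a + b}.
Proof. by move=> a b; apply: functional_extensionality_dep => i; exact: scalerDl. Qed.

HB.instance Definition _ :=
  GRing.Zmodule_isLmodule.Build R (prod_space U) scaleA scale1 scaleDr scaleDl.

Let norm u : R := \big[Num.max/0]_i `|u i|.

Let norm_ge0 u : 0 <= norm u.
Proof. exact: bigmax_ge_id. Qed.

Let norm_ge u i : `|u i| <= norm u.
Proof. exact: le_bigmax. Qed.

Let norm_le u (r : R) : 0 <= r -> (forall i, `|u i| <= r) -> norm u <= r.
Proof. by move=> r0 ur; apply: bigmax_le. Qed.

Let normD u v : norm (u + v) <= norm u + norm v.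
Proof.
apply: norm_le => [|i]; first exact: addr_ge0.
by rewrite (le_trans (ler_normD _ _))// lerD//; exact: norm_ge.
Qed.

Let normZ (a : R) u : norm (a *: u) = `|a| * norm u.
Proof.
apply: le_anti; apply/andP; split.
  apply: norm_le => [|i]; first exact: mulr_ge0.
  by rewrite [(a *: u) i]/(a *: u i) normrZ ler_wpM2l//; exact: norm_ge.
have [->|a0] := eqVneq a 0; first by rewrite normr0 mul0r.
rewrite mulrC -ler_pdivlMr ?normr_gt0//; apply: norm_le => [|i].
  exact: divr_ge0.
by rewrite ler_pdivlMr ?normr_gt0// mulrC -normrZ; exact: norm_ge (a *: u) i.
Qed.

Let norm0_eq0 u : norm u = 0 -> u = 0.
Proof.
move=> u0; apply: functional_extensionality_dep => i.
by apply/eqP; rewrite -normr_le0 -u0; exact: norm_ge.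
Qed.

HB.instance Definition _ :=
  Lmodule_isNormed.Build R (prod_space U) normD normZ norm0_eq0.

Lemma prod_space_normE u : `|u| = \big[Num.max/0]_i `|u i|.
Proof. by []. Qed.

Lemma prod_space_norm_ge u i : `|u i| <= `|u|.
Proof. exact: norm_ge. Qed.

Lemma prod_space_norm_le u (r : R) :
  0 <= r -> (forall i, `|u i| <= r) -> `|u| <= r.
Proof. exact: norm_le. Qed.

End prod_space.

Section prod_space_complete.
Variables (R : realType) (I : finType) (U : I -> completeNormedModType R).

Let prod_cauchy_cvg (F : set_system (prod_space U)) :
  ProperFilter F -> cauchy F -> cvg F.
Proof.
move=> FF /cauchyP Fc.
have ui i : exists l : U i, (fun u : prod_space U => u i) @ F --> l.
  apply/cvg_ex/cauchy_cvgP/cauchyP => e e0.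
  have [u Fu] := Fc e e0; exists (u i).
  suff : F [set v : prod_space U | ball (u i) e (v i)] by [].
  apply: filterS Fu => v; rewrite -!ball_normE/=; apply: le_lt_trans.
  exact: (prod_space_norm_ge (u - v) i).
pose l i := projT1 (cid (ui i)); have Fl i := projT2 (cid (ui i)).
apply/cvg_ex; exists (l : prod_space U); apply/cvgrPdist_le => e e0.
have : \forall u \near F, forall i, `|l i - u i| <= e.
  by apply: filter_forall => i; move: (Fl i) => /cvgrPdist_le; apply.
by apply: filterS => u lu; apply: prod_space_norm_le => //; exact: ltW.
Qed.

HB.instance Definition _ :=
  Uniform_isComplete.Build (prod_space U) prod_cauchy_cvg.

End prod_space_complete.

Definition bounded_op (R : realType) (V W : normedModType R) (f : V -> W) :=
  linear f /\ continuous f.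

(* Topological dual of V, with the operator norm. *)
Definition is_dual (R : realType) (V : normedModType R) :=
  [pred f : V -> R^o | `[< bounded_op f >] ].

Record dual (R : realType) (V : normedModType R) := Dual {
  dual_fun :> V -> R^o;
  dualP : dual_fun \in is_dual V
}.

Section dual.
Variables (R : realType) (V : normedModType R).

HB.instance Definition _ := [isSub of dual V for @dual_fun R V].
HB.instance Definition _ := [Choice of dual V by <:].

Let is_dual_submod : submod_closed (is_dual V).
Proof.
split.
  apply/asboolP; split=> [a x y|]; first by apply/esym; rewrite [LHS](_ : _ = a *: (0 : R^o) + 0)// scaler0; exact: addr0.
  exact: cst_continuous.
move=> a f g /asboolP[lf cf] /asboolP[lg cg].
apply/asboolP; split=> [b x y /=|x].
  have E z : (a *: f + g) z = a * f z + g z by [].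
  rewrite !E lf lg.
  have Z (c z : R) : c *: (z : R^o) = c * z by [].
  rewrite !Z; ring.
by apply: cvgD; [apply: cvgZr; exact: cf|exact: cg].
Qed.

HB.instance Definition _ :=
  GRing.isSubmodClosed.Build R (V -> R^o) (is_dual V) is_dual_submod.
HB.instance Definition _ := [SubChoice_isSubLmodule of dual V by <:].

Implicit Types f g : dual V.


Let norm f : R := sup [set `|f x| | x in [set x | `|x| <= 1]].


Let dual_linear f : linear f.
Proof. by have /asboolP[] := dualP f. Qed.

Let dual0 f : f 0 = 0.
Proof.
have := dual_linear f 1 0 0; rewrite !scale1r addr0 => /eqP.
by rewrite -subr_eq subrr => /eqP.
Qed.

Let dualZ f (a : R) x : f (a *: x) = a * f x.
Proof. by have := dual_linear f a x 0; rewrite dual0 !addr0. Qed.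

Let dual_bounded f : exists2 M, 0 < M & forall x, `|f x| <= M * `|x|.
Proof.
have /asboolP[lf cf] := dualP f.
pose lin := GRing.isLinear.Build R V R^o *:%R (dual_fun f) lf.
pose fl : {linear V -> R^o} := HB.pack (dual_fun f) lin.
have /linear_boundedP/pinfty_ex_gt0[M M0 fM] :=
  continuous_linear_bounded 0 (cf 0 : {for 0, continuous fl}).
by exists M.
Qed.

Let has_sup_norm f : has_sup [set `|f x| | x in [set x | `|x| <= 1]].
Proof.
split; first by exists `|f 0|, 0 => //=; rewrite normr0.
have [M M0 fM] := dual_bounded f; exists M => _ [x /= x1 <-].
by rewrite (le_trans (fM x))// -[leRHS]mulr1 ler_wpM2l// ltW.
Qed.

Let norm_ge f x : `|x| <= 1 -> `|f x| <= norm f.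
Proof. by move=> x1; apply: (ub_le_sup (has_sup_norm f).2); exists x. Qed.

Let norm_le f r : (forall x, `|x| <= 1 -> `|f x| <= r) -> norm f <= r.
Proof.
move=> fr; apply: ge_sup; first by have [] := has_sup_norm f.
by move=> _ [x /= x1 <-]; exact: fr.
Qed.

Let normD f g : norm (f + g) <= norm f + norm g.
Proof.
apply: norm_le => x x1; rewrite (le_trans (ler_normD (f x) (g x)))//.
by rewrite lerD// norm_ge.
Qed.

Let normZ_le (a : R) f : norm (a *: f) <= `|a| * norm f.
Proof.
apply: norm_le => x x1; rewrite [dual_fun _ x]/(a * f x) normrM.
by rewrite ler_wpM2l// norm_ge.
Qed.

Let normZ (a : R) f : norm (a *: f) = `|a| * norm f.
Proof.
apply: le_anti; rewrite normZ_le /=.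
have [->|a0] := eqVneq a 0.
  rewrite normr0 mul0r; apply: le_trans (norm_ge _ (x := 0) _) => //.
  by rewrite normr0.
rewrite mulrC -ler_pdivlMr ?normr_gt0// mulrC -normfV.
by rewrite (le_trans _ (normZ_le _ _))// scalerA mulVf// scale1r.
Qed.

Let norm_eq0 f : norm f = 0 -> f = 0.
Proof.
move=> f0; apply/val_inj/funext => x /=.
have [->|x0] := eqVneq x 0; first exact: dual0.
have : `|f (`|x|^-1 *: x)| <= 0.
  by rewrite -f0 norm_ge// normrZ normfV normr_id mulVf ?normr_eq0.
by rewrite normr_le0 dualZ mulf_eq0 invr_eq0 normr_eq0 (negPf x0)/= => /eqP.
Qed.

HB.instance Definition _ := Lmodule_isNormed.Build R (dual V) normD normZ norm_eq0.

Lemma dual_normE f : `|f| = sup [set `|f x| | x in [set x | `|x| <= 1]].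
Proof. by []. Qed.

End dual.

Section duality.
Variables (R : realType) (V W : normedModType R).

Definition reflexive_space :=
  forall F : dual (dual V), exists v : V, forall phi : dual V, F phi = phi v.

Definition weak_cvg (v_ : nat -> V) (v : V) :=
  forall phi : dual V, phi (v_ n) @[n --> \oo] --> phi v.

(* Sequential version: it is implied by lower semicontinuity for the weak
   topology. *)
Definition weakly_lsc_on (D : set V) (F : V -> R) :=
  forall (v_ : nat -> V) (v : V), (forall n, D (v_ n)) -> D v ->
    weak_cvg v_ v -> ((F v)%:E <= limn_einf (fun n => (F (v_ n))%:E))%E.

Definition adjoint (L : V -> W) (mu : dual W) : V -> R := fun v => mu (L v).

Definition normal_cone (C : set V) (z : V) : set (dual V) :=
  [set zeta | C z /\ forall v, C v -> zeta (v - z) <= 0].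

Definition subdifferential (D : set V) (F : V -> R) (z : V) : set (dual V) :=
  [set g | D z /\ forall v, D v -> F z + g (v - z) <= F v].

Definition compact_embedding (iota : V -> W) :=
  [/\ bounded_op iota, injective iota &
      forall B : set V, bounded_set B -> precompact (iota @` B)].

End duality.

Section bochner.
Variables (R : realType) (Y : normedModType R).
Local Notation mu := (@lebesgue_measure R).

Record simple_map := SimpleMap {
  simple_size : nat;
  simple_set : 'I_simple_size -> set (measurableTypeR R);
  simple_val : 'I_simple_size -> Y;
  simple_measurable : forall k, measurable (simple_set k)
}.

Definition simple_eval (s : simple_map) (t : R) : Y :=
  \sum_(k < simple_size s) \1_(simple_set k) t *: simple_val k.

(* The sets [D] below are bounded intervals, so that the measures are finite. *)
Definition simple_integral (D : set R) (s : simple_map) : Y :=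
  \sum_(k < simple_size s) fine (mu (D `&` simple_set k)) *: simple_val k.

Definition strongly_measurable (D : set R) (g : R -> Y) :=
  exists s : nat -> simple_map,
    {ae mu, forall t, D t -> simple_eval (s n) t @[n --> \oo] --> g t}.

Definition is_bochner_integral (D : set R) (g : R -> Y) (v : Y) :=
  strongly_measurable D g /\
  exists2 s : nat -> simple_map,
    (\int[mu]_(t in D) (`|simple_eval (s n) t - g t|)%:E)%E
      @[n --> \oo] --> 0%E &
    simple_integral D (s n) @[n --> \oo] --> v.

(* Elements of L^p(D; Y) are given by representatives, defined on all of [R];
   equality in L^p is equality almost everywhere on [D]. *)
Definition bochner_Lp (p : nat) (D : set R) (g : R -> Y) :=
  strongly_measurable D g /\ (\int[mu]_(t in D) (`|g t| ^+ p)%:E < +oo)%E.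

End bochner.

Section evolution.
Variables (R : realType) (Y : normedModType R).
Local Notation mu := (@lebesgue_measure R).

(* Only the values of [S] on nonnegative reals are meaningful. *)
Definition c0_semigroup (S : R -> Y -> Y) :=
  [/\ forall t, 0 <= t -> bounded_op (S t),
      forall y, S 0 y = y,
      forall s t y, 0 <= s -> 0 <= t -> S (s + t) y = S s (S t y) &
      forall y, S h y @[h --> 0^'+] --> y].

Definition closed_densely_defined (DA : set Y) (A : Y -> Y) :=
  [/\ DA 0 /\
        forall a x y, DA x -> DA y ->
          DA (a *: x + y) /\ A (a *: x + y) = a *: A x + A y,
      dense DA &
      closed [set xy : Y * Y | DA xy.1 /\ xy.2 = A xy.1]].

Definition generates (DA : set Y) (A : Y -> Y) (S : R -> Y -> Y) :=
  c0_semigroup S /\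
  forall x z, (DA x /\ A x = z) <->
    h^-1 *: (S h x - x) @[h --> 0^'+] --> z.

Definition strongly_continuous_family (T : R) (P : R -> Y -> Y) :=
  (forall t, t \in `[0, T] -> bounded_op (P t)) /\
  forall y, {within `[0, T], continuous (fun t => P t y)}.

Definition linear_weak_to_strong (V : normedModType R) (T : R)
    (B : V -> R -> Y) :=
  [/\ forall u, bochner_Lp 2 `[0, T] (B u),
      forall a u v, {ae mu, forall t, t \in `[0, T] ->
        B (a *: u + v) t = a *: B u t + B v t} &
      forall u_ u, weak_cvg u_ u ->
        (\int[mu]_(t in `[0%R, T]) (`|B (u_ n) t - B u t| ^+ 2)%:E)%E
          @[n --> \oo] --> 0%E].

(* [g] is the inhomogeneity; functions on [0, T] are represented by functions
   on [R] whose values outside [0, T] are irrelevant. *)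
Definition mild_solution (T : R) (S : R -> Y -> Y) (P : R -> Y -> Y)
    (g : R -> Y) (y0 : Y) (y : R -> Y) :=
  {within `[0, T], continuous y} /\
  forall t, t \in `[0, T] ->
    exists2 v, is_bochner_integral `[0, t]
                 (fun tau => S (t - tau) (P tau (y tau) + g tau)) v &
               y t = S t y0 + v.

(* [Sol u] is the unique mild solution in C([0, T]; Y). *)
Definition solution_map (V : Type) (T : R) (S : R -> Y -> Y) (P : R -> Y -> Y)
    (B : V -> R -> Y) (f : R -> Y) (y0 : Y) (Sol : V -> R -> Y) :=
  forall u, mild_solution T S P (B u \+ f) y0 (Sol u) /\
    forall y, mild_solution T S P (B u \+ f) y0 y ->
      {in `[0, T], y =1 Sol u}.

(* [X] is, through [ev], a space of functions from [0, T] to [Y] with pointwise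
   linear operations. *)
Definition function_space_on (X : normedModType R) (T : R)
    (ev : X -> R -> Y) :=
  (forall a x z, {in `[0, T], ev (a *: x + z) =1 a \*: ev x \+ ev z}) /\
  forall x z, {in `[0, T], ev x =1 ev z} -> x = z.

End evolution.

Section game.
Variables (R : realType) (I : finType) (U : I -> normedModType R).
Variables (X W : normedModType R) (iota : X -> W).
Implicit Types (Sol : I -> prod_space U -> X) (K : I -> set W).

Definition prod_set (C : forall i, set (U i)) : set (prod_space U) :=
  [set u | forall i, C i (u i)].

(* [deviation u v] is (v, u_{-i}) for [v : U i]. *)
Definition deviation (u : prod_space U) (i : I) (v : U i) : prod_space U :=
  @dfwith I U u i v.

(* The embedding e_i of U_i into the product. *)
Definition inject (i : I) (v : U i) : prod_space U := deviation 0 v.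

Definition generalized_nash (Uad : forall i, set (U i)) K Sol
    (J : I -> prod_space U -> R) (u : prod_space U) :=
  prod_set Uad u /\
  forall i, K i (iota (Sol i u)) /\
    forall v : U i, Uad i v -> K i (iota (Sol i (deviation u v))) ->
      J i u <= J i (deviation u v).

Definition continuity_point K Sol (i : I) (u : prod_space U) :=
  exists2 e : R, 0 < e &
    ball (0 : W) e `<=` [set iota (Sol i u) - k | k in K i].

Definition kkt (Uad O : forall i, set (U i)) K Sol (Sol0 : I -> prod_space U -> X)
    (J : I -> prod_space U -> R) (u : prod_space U) (Phi : I -> X)
    (lambda : forall i, dual (U i)) (mu : I -> dual W) :=
  forall i, [/\ Phi i = Sol i u,
    normal_cone (Uad i) (u i) (lambda i),
    normal_cone (K i) (iota (Sol i u)) (mu i) &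
    exists2 g : dual (U i),
      subdifferential (O i) (fun v : U i => J i (deviation u v)) (u i) g &
      forall h : U i,
        g h + lambda i h
          + adjoint (fun v : U i => iota (Sol0 i (inject v))) (mu i) h = 0].

End game.

(* Main.v *)
(* A continuity point with respect to player i is a point whose state lies in
   the interior of K_i. At an equilibrium with this property the state constraint
   is therefore inactive: a short step from u*_i towards any v in U_i^ad keeps the
   state in K_i, so by convexity u*_i minimises J_i(., u*_{-i}) on the whole of
   U_i^ad. One may thus take mu = 0, and lambda_i = - g where g in the
   subdifferential of J_i is nonnegative on U_i^ad - u*_i; such a g comes from the
   Hahn-Banach theorem applied to the directional difference quotients of J_i
   relaxed by the cone of U_i^ad at u*_i.
   Conversely, the system makes u*_i a minimiser by adding up the subgradient and
   the two normal cone inequalities along v - u*_i. This uses that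
   S_i(u + a w) = S_i(u) + a S_i^0(w), which follows from uniqueness of mild
   solutions and linearity of the Bochner integral. *)
Require Import Defs.
From HB Require Import structures.
From mathcomp Require Import all_boot all_order all_algebra.
From mathcomp Require Import all_classical all_reals all_analysis.
From mathcomp Require Import measurable_realfun.
From mathcomp Require Import ring lra.

Set Implicit Arguments.
Unset Strict Implicit.
Unset Printing Implicit Defensive.

Import Order.TTheory GRing.Theory Num.Theory.
Import numFieldNormedType.Exports.

Local Open Scope classical_set_scope.
Local Open Scope ring_scope.

(** * Sublinear functionals and the Hahn-Banach theorem *)

Section hahn_banach.
Variables (R : realType) (V : lmodType R).
Implicit Types (p q : V -> R) (x y : V).

(** Homogeneity is asked only as an inequality, the form that passes to infima. Equality follows by
    applying it once more with [a^-1]. *)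
Definition sublinear p :=
  (forall x y, p (x + y) <= p x + p y) /\
  (forall (a : R) x, 0 < a -> p (a *: x) <= a * p x).

Lemma sublinearZ p (a : R) x : sublinear p -> 0 < a -> p (a *: x) = a * p x.
Proof.
move=> [_ pZ] a0; apply/le_anti; rewrite pZ//=.
have := pZ a^-1 (a *: x); rewrite invr_gt0 scalerA mulVf ?gt_eqF// scale1r.
by move=> /(_ a0); rewrite mulrC ler_pdivlMr// mulrC.
Qed.

Lemma sublinear0 p : sublinear p -> p 0 = 0.
Proof.
by move=> sp; have := sublinearZ 0 sp (ltr0Sn _ 1); rewrite scaler0; lra.
Qed.

Lemma sublinearZ_ge0 p (a : R) x : sublinear p -> 0 <= a -> p (a *: x) = a * p x.
Proof.
move=> sp; rewrite le_eqVlt => /predU1P[<-|]; last exact: sublinearZ.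
by rewrite scale0r mul0r sublinear0.
Qed.

(** The common source of all sublinear functionals below. An element of [E (- x)] bounds [E x] from
    below, because the sum of the two dominates an element of [E 0], which is nonnegative. *)
Lemma sublinear_inf (E : V -> set R) :
  (forall x, E x !=set0) -> lbound (E 0) 0 ->
  (forall x y a b, E x a -> E y b -> exists2 c, E (x + y) c & c <= a + b) ->
  (forall (a : R) x b, 0 < a -> E x b -> exists2 c, E (a *: x) c & c <= a * b) ->
  (forall x, has_inf (E x)) /\ sublinear (fun x => inf (E x)).
Proof.
move=> E0 E00 ED EZ.
have Einf x : has_inf (E x).
  split; first exact: E0.
  have [b Eb] := E0 (- x); exists (- b) => a Ea.
  have [c] := ED _ _ _ _ Ea Eb; rewrite subrr => /E00; lra.
split=> //; split=> [x y|a x a0].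
  rewrite -inf_sumE//; apply: lb_le_inf.
    have [[a Ea] [b Eb]] := (E0 x, E0 y).
    by exists (a + b), a => //; exists b.
  move=> _ [a Ea [b Eb <-]]; have [c Ec] := ED _ _ _ _ Ea Eb.
  by apply: le_trans; apply: ge_inf => //; exact: (Einf _).2.
rewrite mulrC -ler_pdivrMr//; apply: lb_le_inf => // b Eb.
rewrite ler_pdivrMr// mulrC; have [c Ec] := EZ _ _ _ a0 Eb.
by apply: le_trans; apply: ge_inf => //; exact: (Einf _).2.
Qed.

(** If additivity failed in a direction [y], [q] could be lowered along the ray of [y]. Additivity
    makes [q] odd, which extends homogeneity to negative scalars. *)
Lemma minimal_sublinear_linear q : sublinear q ->
  (forall r, sublinear r -> (forall x, r x <= q x) -> r = q) ->
  linear (q : V -> R^o).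
Proof.
move=> sq qmin.
have qD x y : q (x + y) = q x + q y.
  apply/le_anti; rewrite sq.1/=.
  (* The infimum of [E z] is sublinear in [z], hence equal to [q z]. *)
  pose E z := [set q (z + t *: y) - t * q y | t in [set t | 0 <= t]].
  have Eq z : E z (q z) by exists 0; rewrite //= scale0r addr0 mul0r subr0.
  have [||||Einf sE] := @sublinear_inf E.
  - by move=> z; exists (q z).
  - by move=> _ [t /= t0 <-]; rewrite add0r sublinearZ_ge0// subrr.
  - move=> z w _ _ [s /= s0 <-] [t /= t0 <-].
    exists (q (z + w + (s + t) *: y) - (s + t) * q y).
      by exists (s + t) => //=; exact: addr_ge0.
    rewrite mulrDl scalerDl addrACA.
    by have := sq.1 (z + s *: y) (w + t *: y); lra.
  - move=> a z _ a0 [t /= t0 <-].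
    exists (q (a *: z + (a * t) *: y) - a * t * q y).
      by exists (a * t) => //=; rewrite mulr_ge0// ltW.
    by rewrite -scalerA -scalerDr sublinearZ// mulrBr mulrA.
  have Ele z b : E z b -> inf (E z) <= b.
    by apply: ge_inf; exact: (Einf z).2.
  have infE z : inf (E z) = q z.
    by have /(congr1 (@^~ z)) := qmin _ sE (fun z => Ele z _ (Eq z)).
  have : inf (E x) <= q (x + y) - q y.
    by apply: Ele; exists 1; rewrite //= scale1r mul1r.
  by rewrite infE; lra.
have qN x : q (- x) = - q x.
  by apply/eqP; rewrite -subr_eq0 opprK -qD addrC subrr sublinear0.
move=> a x y; rewrite qD; congr (_ + _).
have [a0|a0|->] := ltgtP a 0; first 2 last.
- by rewrite !scale0r sublinear0.
- rewrite -[a]opprK [in LHS]scaleNr qN sublinearZ ?oppr_gt0// scaleNr.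
  by [].
- by rewrite sublinearZ.
Qed.

(* Zorn's lemma is applied to the sublinear functionals below [p] instead of
   the partially defined linear ones: the minimal ones are linear. *)
Lemma hahn_banach p : sublinear p ->
  exists2 g : V -> R, linear (g : V -> R^o) & forall x, g x <= p x.
Proof.
move=> sp.
pose T := {q : V -> R | sublinear q /\ forall x, q x <= p x}.
(* The order is reversed, so a maximal element for Zorn's lemma is a minimal functional. *)
pose le_T (q r : T) := `[< forall x, sval r x <= sval q x >].
have [||||q qmin] := @Zorn T le_T.
- by move=> q; apply/asboolP.
- move=> q r s /asboolP rq /asboolP sr; apply/asboolP => x.
  exact: le_trans (sr x) (rq x).
- move=> [q hq] [r hr] /asboolP/= rq /asboolP/= qr; apply/eq_exist/funext => x.
  by apply/le_anti; rewrite qr rq.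
- move=> A totA; have [[q0 Aq0]|A0] := pselect (A !=set0); last first.
    (* The empty chain is bounded by [p] itself; a nonempty one by its pointwise infimum. *)
    exists (exist _ p (conj sp (fun=> lexx _))) => s As.
    by exfalso; apply: A0; exists s.
  pose E x := [set sval q x | q in A].
  have [||||Einf sE] := @sublinear_inf E.
  - by move=> x; exists (sval q0 x), q0.
  - by move=> _ [[q [sq qp]] _ <-]; rewrite sublinear0.
  - move=> x y _ _ [q Aq <-] [r Ar <-].
    (* The smaller of the two functionals, evaluated at [x + y], lies below the mixed sum. *)
    have [/asboolP rq|/asboolP qr] := totA _ _ Aq Ar.
    + exists (sval r (x + y)); first by exists r.
      by rewrite (le_trans ((svalP r).1.1 _ _))// lerD2r.
    + exists (sval q (x + y)); first by exists q.
      by rewrite (le_trans ((svalP q).1.1 _ _))// lerD2l.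
  - move=> a x _ a0 [q Aq <-]; exists (sval q (a *: x)); first by exists q.
    exact: (svalP q).1.2.
  have Ele x (q : T) : A q -> inf (E x) <= sval q x.
    by move=> Aq; apply: ge_inf; [exact: (Einf x).2|exists q].
  have Ep x : inf (E x) <= p x.
    exact: le_trans (Ele x _ Aq0) ((svalP q0).2 x).
  by exists (exist _ (fun x => inf (E x)) (conj sE Ep)) => s As;
    apply/asboolP => x; exact: Ele.
case: q => q [sq qp] in qmin *; exists q => //.
apply: minimal_sublinear_linear => // r sr rq.
have rp x : r x <= p x by exact: le_trans (rq x) (qp x).
have /(congr1 sval) := qmin (exist _ r (conj sr rp)) (asboolT rq).
by [].
Qed.

End hahn_banach.

(** * Minimisation of a convex function on a convex set *)

Section convex_minimum.
Variables (R : realType) (V : normedModType R).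
Implicit Types (C O : set V) (F : V -> R).

Lemma convex_combxx (r : R) (u : V) : u = r *: u + (1 - r) *: u.
Proof. by rewrite -scalerDl addrC subrK scale1r. Qed.

Lemma convex_setP C : convex_set C -> forall x y (t : R),
  C x -> C y -> 0 <= t -> t <= 1 -> C (t *: x + (1 - t) *: y).
Proof.
move=> cC x y t Cx Cy t0 t1.
by have := cC x y (Itv01 t0 t1) (mem_set Cx) (mem_set Cy) => /set_mem.
Qed.

Lemma convex_functionP O F : convex_function O F -> forall x y (t : R),
  O x -> O y -> 0 <= t -> t <= 1 ->
  F (t *: x + (1 - t) *: y) <= t * F x + (1 - t) * F y.
Proof.
move=> cF x y t Ox Oy t0 t1.
exact: (cF (Itv01 t0 t1) x y (mem_set Ox) (mem_set Oy)).
Qed.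

(** A sum of two multiples of [c - u] and [d - u] is the total weight times (a convex combination of
    [c] and [d]) minus [u]. Total weight zero is treated apart, as the convex weights are then
    undefined. *)
Lemma convex_cone C (u : V) : convex_set C -> C u ->
  let T := [set s *: (c - u) | s in [set s : R | 0 <= s] & c in C] in
  forall k l (a b : R), T k -> T l -> 0 <= a -> 0 <= b -> T (a *: k + b *: l).
Proof.
move=> cC Cu T _ _ a b [s /= s0 [c Cc <-]] [t /= t0 [d Cd <-]] a0 b0.
have as0 : 0 <= a * s by exact: mulr_ge0.
have bt0 : 0 <= b * t by exact: mulr_ge0.
have [r0|r0] := eqVneq (a * s + b * t) 0.
  have [as_eq0 bt_eq0] : a * s = 0 /\ b * t = 0 by lra.
  exists 0; rewrite //=; exists u => //.
  by rewrite !scalerA as_eq0 bt_eq0 !scale0r addr0.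
have {}r0 : 0 < a * s + b * t by rewrite lt_neqAle eq_sym r0 addr_ge0.
exists (a * s + b * t); first exact: ltW.
pose r := a * s / (a * s + b * t).
exists (r *: c + (1 - r) *: d).
  apply: convex_setP => //; first by rewrite divr_ge0// ltW.
  by rewrite ler_pdivrMr// mul1r lerDl.
have -> : r *: c + (1 - r) *: d - u = r *: (c - u) + (1 - r) *: (d - u).
  by rewrite {1}(convex_combxx r u) opprD addrACA -!scalerBr.
rewrite scalerDr !scalerA; congr (_ *: _ + _ *: _); rewrite /r; field.
  by rewrite gt_eqF.
by rewrite gt_eqF.
Qed.

(** One functional from Hahn-Banach gives both conclusions. Continuity of [F] enters through the
    bound [F u + 1] on a ball around [u]: it makes each [E h] nonempty and the functional
    continuous. *)
Lemma subdifferential_minimum C O F (u : V) :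
  open O -> convex_set O -> convex_function O F -> {within O, continuous F} ->
  convex_set C -> C `<=` O -> C u -> (forall v, C v -> F u <= F v) ->
  exists2 g : dual V, subdifferential O F u g &
    forall v, C v -> 0 <= g (v - u).
Proof.
move=> oO cO /convex_functionP cF ctF cC CO Cu Fu.
have Ou : O u by exact: CO.
pose T := [set s *: (c - u) | s in [set s : R | 0 <= s] & c in C].
have TD := convex_cone cC Cu; rewrite -/T in TD.
have T0 : T 0 by exists 0; rewrite //=; exists u; rewrite // scale0r.
(* Minimality extends from [C] to the part of [u + T] in [O]: for [s > 1] the point [c] lies between
   [u] and [u + k], and convexity carries the bound from [c] outwards. This is what makes [E 0]
   nonnegative. *)
have FT k : T k -> O (u + k) -> F u <= F (u + k).
  move=> [s /= s0 [c Cc <-]] Oc; have [s1|s1] := leP s 1.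
    apply: Fu; have := convex_setP cC Cc Cu s0 s1.
    by rewrite scalerBl scale1r scalerBr addrCA addrA.
  have {}s0 : 0 < s by exact: lt_trans s1.
  have sV : s^-1 <= 1 by rewrite invf_le1// ltW.
  have sV0 : 0 < s^-1 by rewrite invr_gt0.
  have := cF _ _ _ Oc Ou (ltW sV0) sV.
  rewrite (_ : _ *: _ + _ = c).
    move=> /(le_trans (Fu _ Cc)) => H.
    rewrite -subr_ge0 -(pmulr_rge0 _ sV0); lra.
  rewrite scalerDr addrAC -convex_combxx scalerA mulVf ?gt_eqF// scale1r.
  by rewrite addrC subrK.
(* The infimum of [E h] is at most the directional derivative of [F] at [u] along
   [h] (take [k = 0]) and nonpositive for [h = u - v], [v] in [C]
   (take [k = v - u]). *)
pose E h := [set a | exists t k,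
  [/\ 0 < t, T k, O (u + (t *: h + k)) & a = (F (u + (t *: h + k)) - F u) / t]].
have [d d0 ud] : exists2 d : R, 0 < d &
    forall h, `|h| < d -> O (u + h) /\ F (u + h) <= F u + 1.
  have : \forall x \near u, O x /\ F x <= F u + 1.
    near=> x; split; first by near: x; exact: open_nbhs_nbhs.
    have : `|F u - F x| < 1.
      near: x; apply: (cvgrPdist_lt _ _).1 => //.
      by move: ctF; rewrite (continuous_open_subspace _ oO); apply; rewrite inE.
    by move=> /ltr_normlP[]; lra.
  move=> /nbhs_normP[d /= d0 ud]; exists d => // h hd.
  by apply: ud; rewrite /= opprD addNKr normrN.
have Ed (h : V) (t : R) : 0 < t -> `|t *: h| < d -> exists2 a, E h a & a <= t^-1.
  move=> t0 /ud[Oh Fh]; exists ((F (u + t *: h) - F u) / t).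
    by exists t, 0; rewrite addr0.
  by rewrite ler_pdivrMr// mulVf ?gt_eqF//; lra.
have [||||Einf sE] := @sublinear_inf R V E.
- move=> h; have [t t0 ht] : exists2 t : R, 0 < t & `|t *: h| < d.
    exists (d / (`|h| + 1)); first by rewrite divr_gt0// ltr_wpDl.
    rewrite normrZ ger0_norm ?divr_ge0 ?addr_ge0// ?(ltW d0)//.
    rewrite mulrAC ltr_pdivrMr ?ltr_wpDl// ltr_pM2l//; lra.
  by have [a Ea _] := Ed _ _ t0 ht; exists a.
- move=> b [t [k [t0 Tk]]]; rewrite scaler0 add0r => Ok ->.
  by rewrite divr_ge0 ?(ltW t0)// subr_ge0 FT.
- move=> x y a b [t [k [t0 Tk Ok aE]]] [s [l [s0 Tl Ol bE]]].
  have ts0 : 0 < t + s by exact: addr_gt0.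
  (* This weight balances the two steps, [r * t = (1 - r) * s], so the convex combination of the two
     points moves from [u] by that common step along [x + y], plus an element of [T]. *)
  pose r := s / (t + s).
  have r0 : 0 <= r by rewrite divr_ge0// ltW.
  have r1 : r <= 1 by rewrite ler_pdivrMr// mul1r lerDr ltW.
  have r10 : 0 <= 1 - r by rewrite subr_ge0.
  have tr : t * s / (t + s) = r * t by rewrite -mulrA mulrC.
  have tr' : t * s / (t + s) = (1 - r) * s.
    by rewrite /r; field; rewrite gt_eqF.
  have ptE : u + ((t * s / (t + s)) *: (x + y) + (r *: k + (1 - r) *: l)) =
      r *: (u + (t *: x + k)) + (1 - r) *: (u + (s *: y + l)).
    rewrite {1}(convex_combxx r u) !scalerDr !scalerA {1}tr tr'.
    by rewrite [RHS]addrACA; congr (_ + _); exact: addrACA.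
  exists ((F (u + ((t * s / (t + s)) *: (x + y) + (r *: k + (1 - r) *: l)))
      - F u) / (t * s / (t + s))).
    exists (t * s / (t + s)), (r *: k + (1 - r) *: l); split=> //.
    + by apply: divr_gt0 => //; exact: mulr_gt0.
    + exact: TD.
    + by rewrite ptE; exact: convex_setP.
  rewrite ler_pdivrMr; last by rewrite divr_gt0// mulr_gt0.
  rewrite ptE.
  have := cF _ _ _ Ok Ol r0 r1.
  rewrite (_ : F (u + (t *: x + k)) = F u + a * t); last first.
    by rewrite aE divfK ?gt_eqF// [RHS]addrC subrK.
  rewrite (_ : F (u + (s *: y + l)) = F u + b * s); last first.
    by rewrite bE divfK ?gt_eqF// [RHS]addrC subrK.
  move=> /le_trans H; rewrite lerBlDr; apply: H.
  by rewrite [(a + b) * _]mulrDl {1}tr tr'; lra.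
- move=> a x b a0 [t [k [t0 Tk Ok ->]]].
  exists ((F (u + (t *: x + k)) - F u) / (t / a)).
    by exists (t / a), k; rewrite scalerA divfK ?gt_eqF//; split => //;
      rewrite divr_gt0.
  by rewrite invf_div mulrCA mulrA mulrAC -mulrA.
have Ele x b : E x b -> inf (E x) <= b.
  by apply: ge_inf; exact: (Einf x).2.
have [g lg gE] := hahn_banach sE.
pose lin := GRing.isLinear.Build R V R^o *:%R g lg.
pose gl : {linear V -> R^o} := HB.pack g lin.
(* A step of length [d / 2] keeps the unit ball strictly inside the radius [d] where [F] is
   bounded. *)
have gd (h : V) : `|h| <= 1 -> g h <= (d / 2)^-1.
  move=> h1; have d20 : 0 < d / 2 by rewrite divr_gt0.
  have [|a Ea] := Ed h (d / 2) d20; last first.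
    by apply: le_trans; rewrite (le_trans (gE h))// Ele.
  rewrite normrZ gtr0_norm// (@le_lt_trans _ _ (d / 2))//; last lra.
  by rewrite -[leRHS]mulr1 ler_wpM2l// ltW.
have gN h : g (- h) = - g h by exact: (linearN gl).
have cg : continuous gl.
  apply: bounded_linear_continuous; apply/ex_bound; exists (d / 2)^-1.
  apply/nbhs_norm0P; exists 1 => //= h /ltW h1.
  suff : `|(g h : R)| <= (d / 2)^-1 by [].
  by rewrite ler_norml gd// lerNl -gN gd// normrN.
have gd_dual : g \in is_dual V by apply/asboolP; split.
exists (Dual gd_dual) => /=; last first.
  move=> v Cv; rewrite -oppr_le0 -gN opprB.
  apply: le_trans (gE _) _; apply: Ele; exists 1, (v - u).
  have -> : u + (1 *: (u - v) + (v - u)) = u.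
    by rewrite scale1r -(opprB u v) subrr addr0.
  rewrite subrr mul0r; split=> //.
  by exists 1; rewrite //=; exists v => //; rewrite scale1r.
split=> // v Ov; rewrite -lerBrDl.
have vE : u + (1 *: (v - u) + 0) = v by rewrite scale1r addr0 addrC subrK.
apply: le_trans (gE _) _; apply: Ele; exists 1, 0.
by rewrite vE divr1.
Unshelve. all: by end_near. Qed.

End convex_minimum.

(** * Inactive constraints in convex minimisation *)

Section minimum_inactive_constraint.
Variables (R : realType) (V W : normedModType R).

(** A short step from [u] towards [v] moves [G] by less than [e], hence stays feasible. Convexity of
    [F] on the segment then transfers the inequality to [v]. *)
Lemma minimum_inactive_constraint (C O : set V) (K : set W) (F : V -> R)
    (G D : V -> W) (u : V) (e : R) :
  convex_set C -> convex_function O F -> C `<=` O -> C u -> 0 < e ->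
  (forall v t, C v -> G (u + t *: (v - u)) = t *: D v + G u) ->
  (forall w, `|w| < e -> K (w + G u)) ->
  (forall v, C v -> K (G v) -> F u <= F v) ->
  forall v, C v -> F u <= F v.
Proof.
move=> cC /convex_functionP cF CO Cu e0 GD KG Fu v Cv.
(* The bound by 1 keeps the point on the segment, the other makes the displacement at most [e / 2];
   adding 1 keeps the denominator positive when [D v = 0]. *)
pose t := Num.min 1 (e / (2 * (`|D v| + 1))).
have D1 : 0 < `|D v| + 1 by rewrite ltr_wpDl.
have t0 : 0 < t by rewrite lt_min ltr01/= divr_gt0// mulr_gt0.
have t1 : t <= 1 by rewrite ge_min lexx.
have tD : `|t *: D v| < e.
  rewrite normrZ gtr0_norm//.
  apply: (@le_lt_trans _ _ (e / (2 * (`|D v| + 1)) * (`|D v| + 1))).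
    by apply: ler_pM => //; [exact: ltW|rewrite ge_min lexx orbT|rewrite lerDl].
  by rewrite invfM mulrA divfK ?gt_eqF//; lra.
have vtE : u + t *: (v - u) = t *: v + (1 - t) *: u.
  by rewrite {1}(convex_combxx t u) scalerBr addrC addrA subrK.
have Cvt : C (u + t *: (v - u)) by rewrite vtE; apply: convex_setP => //; exact: ltW.
have Kvt : K (G (u + t *: (v - u))) by rewrite GD//; exact: KG.
have := le_trans (Fu _ Cvt Kvt) _; rewrite vtE.
move=> /(_ _ (cF _ _ _ (CO _ Cv) (CO _ Cu) (ltW t0) t1)).
by move=> H; rewrite -subr_ge0 -(pmulr_rge0 _ t0); lra.
Qed.

End minimum_inactive_constraint.
(** * Linearity of the Bochner integral *)

Section integral_ae.
Local Open Scope ereal_scope.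
Context d (T : measurableType d) (R : realType).
Variable mu : {measure set T -> \bar R}.
Import HBNNSimple.

(* No measurability of [f] and [g]: for nonnegative functions the integral is a
   supremum over the simple functions below the integrand. *)
Lemma ge0_le_integral_ae (A B N : set T) (f g : T -> \bar R) :
  measurable N -> mu N = 0 ->
  (forall x, A x -> 0 <= f x) -> (forall x, B x -> 0 <= g x) ->
  (forall x, ~ N x -> A x -> B x /\ f x <= g x) ->
  \int[mu]_(x in A) f x <= \int[mu]_(x in B) g x.
Proof.
move=> mN N0 f0 g0 fg; rewrite !ge0_integralE//.
apply: ge_ereal_sup => _ [h /= hf <-].
have mNC : measurable (setT `\` N) by exact: measurableD.
(* Cutting [h] off on the null set [N] preserves its integral and puts it below [g] on [B]. *)
suff -> : sintegral mu h = sintegral mu (proj_nnsfun h mNC).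
  apply: ereal_sup_ubound; exists (proj_nnsfun h mNC) => //= x.
  have gB0 : 0 <= (g \_ B) x.
    by rewrite patchE; case: ifPn => // /set_mem; exact: g0.
  rewrite [X in X%:E](_ : _ = (h \_ (setT `\` N)) x); last by rewrite mrestrict.
  rewrite patchE; case: ifPn => // /set_mem[_ Nx].
  apply: le_trans (hf x) _; rewrite patchE.
  case: ifPn => // /set_mem Ax; have [Bx fgx] := fg _ Nx Ax.
  by rewrite patchE mem_set.
rewrite -integralT_nnsfun (ge0_negligible_integral mN)//; last 2 first.
- by apply/measurable_EFinP; exact: measurable_funTS.
- by move=> x _; rewrite lee_fin.
by rewrite integral_nnsfun// mrestrict.
Qed.

End integral_ae.

Section bochner_linear.
Variables (R : realType) (Y : normedModType R).
Local Notation mu := (@lebesgue_measure R).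
Implicit Types (s : simple_map Y) (D : set R) (g : R -> Y).

(** Finitely many values on measurable sets make an arbitrary [phi] admissible; this freedom lets
    the induction absorb the first value as a translation inside [phi]. *)
Lemma measurable_simple_eval s (phi : Y -> R) :
  measurable_fun [set: measurableTypeR R] (fun t => phi (simple_eval s t)).
Proof.
case: s => n A v mA; rewrite /simple_eval/=.
elim: n A v mA phi => [|n IH] A v mA phi.
  by under eq_fun do rewrite big_ord0; exact: measurable_cst.
under eq_fun do rewrite big_ord_recl/=.
rewrite (_ : (fun t => _) = fun t => if t \in A ord0 then
    phi (v ord0 + \sum_(i < n) \1_(A (lift ord0 i)) t *: v (lift ord0 i))
  else phi (\sum_(i < n) \1_(A (lift ord0 i)) t *: v (lift ord0 i))).
  apply: measurable_fun_ifT.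
  - by apply: (measurable_fun_bool true); rewrite setTI (_ : _ @^-1` _ = A ord0)//;
      apply/seteqP; split => [t /set_mem|t At]//; exact: mem_set.
  - by apply: (IH (fun i => A (lift ord0 i)) (fun i => v (lift ord0 i)) _
      (fun y => phi (v ord0 + y))) => i.
  - by apply: (IH (fun i => A (lift ord0 i)) (fun i => v (lift ord0 i))) => i.
apply/funext => t; rewrite indicE; case: ifPn => _; first by rewrite scale1r.
by rewrite scale0r add0r.
Qed.

(** The sets of a simple map may overlap, so concatenation replaces a common refinement. *)
Definition simple_lincomb (a : R) s1 s2 : simple_map Y :=
  @SimpleMap R Y (simple_size s1 + simple_size s2)
    (fun k => match fintype.split k with
              | inl i => @simple_set R Y s1 i | inr j => @simple_set R Y s2 j end)
    (fun k => match fintype.split k with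
              | inl i => a *: @simple_val R Y s1 i | inr j => @simple_val R Y s2 j end)
    (fun k => match fintype.split k as u return measurable
        (match u with inl i => @simple_set R Y s1 i | inr j => @simple_set R Y s2 j end)
      with inl i => @simple_measurable R Y s1 i | inr j => @simple_measurable R Y s2 j end).

Lemma split_lshift m n (i : 'I_m) : fintype.split (lshift n i) = inl i.
Proof. exact: (@unsplitK m n (inl i)). Qed.

Lemma split_rshift m n (i : 'I_n) : fintype.split (rshift m i) = inr i.
Proof. exact: (@unsplitK m n (inr i)). Qed.

Lemma simple_lincombE a s1 s2 t :
  simple_eval (simple_lincomb a s1 s2) t = a *: simple_eval s1 t + simple_eval s2 t.
Proof.
rewrite /simple_eval/= big_split_ord/= scaler_sumr; congr (_ + _).
  by apply: eq_bigr => i _; rewrite split_lshift !scalerA mulrC.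
by apply: eq_bigr => i _; rewrite split_rshift.
Qed.

Lemma simple_integral_lincomb D a s1 s2 :
  simple_integral D (simple_lincomb a s1 s2) =
  a *: simple_integral D s1 + simple_integral D s2.
Proof.
rewrite /simple_integral/= big_split_ord/= scaler_sumr; congr (_ + _).
  by apply: eq_bigr => i _; rewrite split_lshift !scalerA mulrC.
by apply: eq_bigr => i _; rewrite split_rshift.
Qed.

(** The combined approximants have error at most [|a|] times the first error plus the second.
    Splitting the integral of that bound uses measurable errors, available off a null set [N] where
    [g1] and [g2] are limits of simple maps. *)
Lemma is_bochner_integral_lincomb D (a : R) g1 g2 g v1 v2 :
  measurable (D : set (measurableTypeR R)) ->
  is_bochner_integral D g1 v1 -> is_bochner_integral D g2 v2 ->
  {ae mu, forall t, D t -> g t = a *: g1 t + g2 t} ->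
  is_bochner_integral D g (a *: v1 + v2).
Proof.
have aeF := ae_filter_ringOfSetsType mu.
move=> mD [[s1 s1g] [r1 ir1 vr1]] [[s2 s2g] [r2 ir2 vr2]] gE; split.
  exists (fun n => simple_lincomb a (s1 n) (s2 n)).
  apply: filterS3 s1g s2g gE => t s1g s2g gE Dt.
  rewrite gE//; under eq_fun do rewrite simple_lincombE.
  by apply: cvgD; [apply: cvgZr; exact: s1g|exact: s2g].
exists (fun n => simple_lincomb a (r1 n) (r2 n)); last first.
  under eq_fun do rewrite simple_integral_lincomb.
  by apply: cvgD => //; exact: cvgZr.
have [N [mN N0 NE]] : {ae mu, forall t, D t ->
    [/\ g t = a *: g1 t + g2 t, simple_eval (s1 n) t @[n --> \oo] --> g1 t &
        simple_eval (s2 n) t @[n --> \oo] --> g2 t]}.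
  by apply: filterS3 s1g s2g gE => t s1g s2g gE Dt; split; auto.
have {}NE t : ~ N t -> D t ->
    [/\ g t = a *: g1 t + g2 t, simple_eval (s1 n) t @[n --> \oo] --> g1 t &
        simple_eval (s2 n) t @[n --> \oo] --> g2 t].
  by move=> Nt Dt; apply: contrapT => H; apply: Nt; apply: NE => /= /(_ Dt).
have mDN : measurable (D `\` N : set (measurableTypeR R)) by exact: measurableD.
have mh (s : nat -> simple_map Y) r (h : R -> Y) :
    (forall t, ~ N t -> D t -> simple_eval (s n) t @[n --> \oo] --> h t) ->
    measurable_fun (D `\` N : set (measurableTypeR R))
      (fun t => `|simple_eval r t - h t|%:E).
  move=> sh; apply/measurable_EFinP.
  apply: (@measurable_fun_cvg _ (measurableTypeR R) R _
    (fun m t => `|simple_eval r t - simple_eval (s m) t|)).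
    move=> m; apply: measurable_funTS.
    have := measurable_simple_eval (simple_lincomb (-1) (s m) r) (fun y => `|y|).
    by under eq_fun do rewrite simple_lincombE scaleN1r addrC.
  by move=> t [Dt Nt]; apply: cvg_norm; apply: cvgB; [exact: cvg_cst|exact: sh].
apply: (@squeeze_cvge _ _ _ _ (cst 0%E) _ (fun n =>
  `|a|%:E * \int[mu]_(t in D) (`|simple_eval (r1 n) t - g1 t|)%:E +
  \int[mu]_(t in D) (`|simple_eval (r2 n) t - g2 t|)%:E)%E).
- apply: nearW => n; apply/andP; split; first by apply: integral_ge0.
  (* Passing to [D] without [N] for the splitting, and back to [D] afterwards. *)
  apply: (@le_trans _ _ (\int[mu]_(t in D `\` N)
    (`|a|%:E * `|simple_eval (r1 n) t - g1 t|%:E +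
     `|simple_eval (r2 n) t - g2 t|%:E))%E).
    apply: (@ge0_le_integral_ae _ (measurableTypeR R) R mu _ _ N) => //.
      by move=> t _; rewrite -EFinM -EFinD lee_fin addr_ge0// mulr_ge0.
    move=> t Nt Dt; split=> //; have [gE' _ _] := NE _ Nt Dt.
    rewrite -EFinM -EFinD lee_fin simple_lincombE gE' -normrZ opprD addrACA.
    by rewrite scalerBr ler_normD.
  rewrite ge0_integralD//; last 2 first.
  + by apply: measurable_funeM; apply: (mh s1) => t Nt Dt; have [] := NE _ Nt Dt.
  + by apply: (mh s2) => t Nt Dt; have [] := NE _ Nt Dt.
  rewrite ge0_integralZl//; last 1 first.
  + by apply: (mh s1) => t Nt Dt; have [] := NE _ Nt Dt.
  apply: leeD.
    apply: lee_wpmul2l; first by rewrite lee_fin.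
    by apply: (@ge0_le_integral_ae _ (measurableTypeR R) R mu _ _ N) => // t Nt [].
  by apply: (@ge0_le_integral_ae _ (measurableTypeR R) R mu _ _ N) => // t Nt [].
- exact: cvg_cst.
- have a_fin : `|a|%:E \is a fin_num by [].
  have := cvgeZl a_fin ir1; rewrite mule0 => air1.
  have def00 : (0%E +? (0%E : \bar R))%E by [].
  by have := cvgeD def00 air1 ir2; rewrite adde0; apply.
Qed.

End bochner_linear.
(** * The game *)

Section solution_map.
Variables (R : realType) (V X Y : normedModType R) (T : R).
Variables (S P : R -> Y -> Y) (B : V -> R -> Y) (ev : X -> R -> Y).
Hypotheses (S_c0 : c0_semigroup S)
  (P_cont : strongly_continuous_family T P) (B_wts : linear_weak_to_strong T B)
  (X_fun : function_space_on T ev).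

(** The combination of two mild solutions solves the equation with combined data, so uniqueness
    identifies it with [Sol3] on [[0, T]]; elements of [X] are determined by these values. *)
Lemma solution_map_lincomb (a : R) (f1 f2 f3 : R -> Y) (y1 y2 y3 : Y)
    (Sol1 Sol2 Sol3 : V -> X) (u1 u2 : V) :
  f3 = a \*: f1 \+ f2 -> y3 = a *: y1 + y2 ->
  solution_map T S P B f1 y1 (fun u => ev (Sol1 u)) ->
  solution_map T S P B f2 y2 (fun u => ev (Sol2 u)) ->
  solution_map T S P B f3 y3 (fun u => ev (Sol3 u)) ->
  Sol3 (a *: u1 + u2) = a *: Sol1 u1 + Sol2 u2.
Proof.
move=> f3E y3E sol1 sol2 sol3; apply/esym/X_fun.2 => t tT; rewrite X_fun.1//.
have [[c1 m1] _] := sol1 u1; have [[c2 m2] _] := sol2 u2.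
apply: (sol3 _).2 (tT); split.
  by move=> x; apply: cvgD; [apply: cvgZr; exact: c1|exact: c2].
move=> {tT}t tT; have [v1 b1 e1] := m1 t tT; have [v2 b2 e2] := m2 t tT.
have t0 : 0 <= t by move: tT; rewrite in_itv/= => /andP[].
have tT' : t <= T by move: tT; rewrite in_itv/= => /andP[].
have Slin s : 0 <= s -> linear (S s) by case: S_c0 => + _ _ _ => /[apply]-[].
exists (a *: v1 + v2); last by rewrite /= e1 e2 y3E Slin// scalerDr addrACA.
apply: is_bochner_integral_lincomb b1 b2 _; first exact: measurable_itv.
have [_ Blin _] := B_wts; have aeF := ae_filter_ringOfSetsType (@lebesgue_measure R).
apply: filterS (Blin a u1 u2) => s Bs; rewrite /= in_itv/= => /andP[s0 st].
have sT : s \in `[0, T] by rewrite in_itv/= s0 (le_trans st).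
have [Plin _] := P_cont.1 _ sT.
rewrite Bs// -Slin ?subr_ge0//; congr (S _ _).
by rewrite Plin f3E/= !scalerDr [RHS]addrACA; congr (_ + _); exact: addrACA.
Qed.

End solution_map.

Section deviation.
Variables (R : realType) (I : finType) (U : I -> normedModType R).
Implicit Types u : prod_space U.

Lemma deviation_id u i : deviation u (u i) = u.
Proof.
apply: functional_extensionality_dep => j; rewrite /deviation.
by have [<-|ij] := eqVneq i j; [rewrite dfwithin|rewrite dfwithout].
Qed.

(** Puts a unilateral change of strategy in the affine form to which [solution_map_lincomb]
    applies. *)
Lemma deviationD u i (v : U i) (t : R) :
  deviation u (u i + t *: v) = t *: inject v + u.
Proof.
apply: functional_extensionality_dep => j; rewrite /inject /deviation.
rewrite [RHS](_ : _ = t *: @dfwith I U (0 : prod_space U) i v j + u j)//.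
have [ij|ij] := eqVneq i j; last by rewrite !dfwithout// scaler0 add0r.
by case: _ / ij; rewrite !dfwithin addrC.
Qed.

End deviation.

(** * Necessity and sufficiency of the optimality system for equilibria *)

Theorem theorem5p2 (R : realType) (N : nat) (T : R)
  (U : 'I_N -> completeNormedModType R) (X Y W : completeNormedModType R)
  (DA : set Y) (A : Y -> Y) (S : R -> Y -> Y)
  (P : 'I_N -> R -> Y -> Y) (B : 'I_N -> prod_space U -> R -> Y)
  (f : R -> Y) (y0 : Y)
  (ev : X -> R -> Y) (iota : X -> W)
  (Sol Sol0 : 'I_N -> prod_space U -> X)
  (Uad O : forall i, set (U i)) (K : 'I_N -> set W)
  (J : 'I_N -> prod_space U -> R)
  (N_gt1 : (1 < N)%N) (T_gt0 : 0 < T)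
  (U_reflexive : forall i, reflexive_space (U i))
  (A_closed : closed_densely_defined DA A)
  (A_generates : generates DA A S)
  (B_wts : forall i, linear_weak_to_strong T (B i))
  (P_cont : forall i, strongly_continuous_family T (P i))
  (f_L1 : bochner_Lp 1 `[0, T] f)
  (X_fun : function_space_on T ev)
  (SolE : forall i,
    solution_map T S (P i) (B i) f y0 (fun u => ev (Sol i u)))
  (Sol0E : forall i,
    solution_map T S (P i) (B i) (cst 0) 0 (fun u => ev (Sol0 i u)))
  (Sol_lip : forall i, [lipschitz Sol i u | u in setT])
  (XW : compact_embedding iota)
  (Uad_spec : forall i,
    [/\ Uad i !=set0, bounded_set (Uad i), closed (Uad i) & convex_set (Uad i)])
  (O_spec : forall i, [/\ open (O i), convex_set (O i) & Uad i `<=` O i])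
  (J_wlsc : forall i, weakly_lsc_on (prod_set O) (J i))
  (J_convex : forall i (u : prod_space U), (forall k, k != i -> O k (u k)) ->
    convex_function (O i) (fun v : U i => J i (deviation u v)))
  (J_cont : forall i (u : prod_space U), (forall k, k != i -> O k (u k)) ->
    {within O i, continuous (fun v : U i => J i (deviation u v))})
  (K_spec : forall i, [/\ K i !=set0, closed (K i) & convex_set (K i)])
  (feasible : exists2 u, prod_set Uad u & forall i, K i (iota (Sol i u))) :
  (forall u : prod_space U,
     generalized_nash iota Uad K Sol J u ->
     (forall i, continuity_point iota K Sol i u) ->
     exists (Phi : 'I_N -> X) (lambda : forall i, dual (U i))
       (mu : 'I_N -> dual W),
       kkt iota Uad O K Sol Sol0 J u Phi lambda mu) /\
  (forall (u : prod_space U) (Phi : 'I_N -> X) (lambda : forall i, dual (U i))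
     (mu : 'I_N -> dual W),
     kkt iota Uad O K Sol Sol0 J u Phi lambda mu ->
     generalized_nash iota Uad K Sol J u).

Proof.
have SolD i (a : R) u v : Sol i (a *: v + u) = a *: Sol0 i v + Sol i u.
  apply: (solution_map_lincomb A_generates.1 (P_cont i) (B_wts i) X_fun v u _ _
    (Sol0E i) (SolE i) (SolE i)); last by rewrite scaler0 add0r.
  by apply/funext => t; rewrite /= scaler0 add0r.
have [[iota_lin _] _ _] := XW.
have devE i u v (t : R) : iota (Sol i (deviation u (u i + t *: (v - u i)))) =
    t *: iota (Sol0 i (inject (v - u i))) + iota (Sol i u).
  by rewrite deviationD SolD iota_lin.
split=> [u [uad eq_u] cont_u|u Phi lambda mu kkt_u]; last first.
  have uad : prod_set Uad u by move=> i; have [_ []] := kkt_u i.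
  have uO j : O j (u j) by have [_ _ +] := O_spec j; apply; exact: uad.
  split=> // i; have [_ [_ lambda_le] [Ku mu_le] [g [_ g_le] glm]] := kkt_u i.
  split=> // v vad Kv.
  have vO : O i v by have [_ _ +] := O_spec i; apply.
  have := g_le _ vO; rewrite deviation_id; apply: le_trans.
  (* With [t = 1] in [devE], the state difference is the linear part applied to [v - u i]. Both
     multiplier terms are then nonpositive, which forces [g (v - u i)] to be nonnegative. *)
  have := glm (v - u i); rewrite /adjoint.
  have := lambda_le _ vad; have := mu_le _ Kv.
  have := devE i u v 1; rewrite !scale1r addrC subrK => ->.
  by rewrite addrK; lra.
have min_u i : exists2 g : dual (U i),
    subdifferential (O i) (fun v : U i => J i (deviation u v)) (u i) g &
    forall v, Uad i v -> 0 <= g (v - u i).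
  have uO j : j != i -> O j (u j).
    by move=> _; have [_ _ +] := O_spec j; apply; exact: uad.
  have [_ _ _ Uad_cvx] := Uad_spec i; have [oO O_cvx UadO] := O_spec i.
  apply: subdifferential_minimum => //; [exact: J_convex|exact: J_cont|].
  have [e e0 eK] := cont_u i.
  apply: (minimum_inactive_constraint (O := O i) (K := K i) (e := e)
    (G := fun v => iota (Sol i (deviation u v)))
    (D := fun v => iota (Sol0 i (inject (v - u i))))) => //.
  - exact: J_convex.
  - by move=> v t _; rewrite devE deviation_id.
  - move=> w we; rewrite deviation_id.
    (* The continuity point writes ball elements as state minus [k], so [- w] is the one that yields
       [k] equal to [w] plus the state. *)
    have [|k Kk kE] := eK (- w); first by rewrite -ball_normE/= sub0r opprK.
    suff -> : w + iota (Sol i u) = k by [].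
    by rewrite -[w]opprK -kE opprB subrK.
  - by move=> v vad Kv; rewrite deviation_id; apply: (eq_u i).2.
pose g i : dual (U i) := projT1 (cid2 (min_u i)).
exists (Sol^~ u), (fun i => - g i), (fun=> 0) => i.
have [g_sub g_ge0] : subdifferential (O i) (fun v : U i => J i (deviation u v))
    (u i) (g i) /\ forall v, Uad i v -> 0 <= g i (v - u i).
  by rewrite /g; case: cid2.
split=> //.
- by split=> [|v vad]; [exact: uad|rewrite oppr_le0; exact: g_ge0].
- by split=> //; exact: (eq_u i).1.
- by exists (g i) => // h; rewrite /adjoint/= subrr addr0.
Qed.
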